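(* For every integer $n\ge 1$ and every odd integer $d\ge 3$, $$\tfrac12 n^{d/2}-O(n^{(d-1)/2}) < \eta(P_n^d)\le \sqrt{2(d-1)}\,n^{d/2}+3.$$
   Context: All graphs are finite, simple and undirected. $P_n$ is the path on $n$ vertices. The Cartesian product $G\,\square\,H$ has vertex set $V(G)\times V(H)$, with $(v,x)(w,y)$ an edge iff ($vw\in E(G)$ and $x=y$) or ($v=w$ and $xy\in E(H)$); $P_n^d$ is the $d$-fold Cartesian product $P_n\,\square\,\cdots\,\square\,P_n$. $\eta(G)$ is the maximum $k$ such that $K_k$ is a minor of $G$. The $O$-term is with respect to $n$ for fixed $d$. *)

(* Defs.v *)
From mathcomp Require Import all_boot.

Set Implicit Arguments.
Unset Strict Implicit.
Unset Printing Implicit Defensive.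

Record sgraph := SGraph {
  vertex :> finType;
  adj : rel vertex;
  adj_sym : symmetric adj;
  adj_irrefl : irreflexive adj }.

Definition path_rel n : rel 'I_n :=
  fun i j => ((i : nat).+1 == j) || ((j : nat).+1 == i).

Lemma path_rel_sym n : symmetric (@path_rel n).
Proof. by move=> i j; rewrite /path_rel orbC. Qed.

Lemma path_rel_irrefl n : irreflexive (@path_rel n).
Proof. by move=> i; rewrite /path_rel orbb eqn_leq ltnn. Qed.

Definition path_graph n : sgraph :=
  SGraph (@path_rel_sym n) (@path_rel_irrefl n).

Definition complete_rel k : rel 'I_k := fun i j => i != j.

Lemma complete_rel_sym k : symmetric (@complete_rel k).
Proof. by move=> i j; rewrite /complete_rel eq_sym. Qed.

Lemma complete_rel_irrefl k : irreflexive (@complete_rel k).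
Proof. by move=> i; rewrite /complete_rel eqxx. Qed.

Definition complete_graph k : sgraph :=
  SGraph (@complete_rel_sym k) (@complete_rel_irrefl k).

Section Cartesian.
Variables G H : sgraph.

Definition cart_rel : rel (G * H)%type := fun p q =>
  (adj p.1 q.1 && (p.2 == q.2)) || ((p.1 == q.1) && adj p.2 q.2).

Lemma cart_rel_sym : symmetric cart_rel.
Proof.
by move=> p q; rewrite /cart_rel (adj_sym p.1) (adj_sym p.2) (eq_sym p.1)
  (eq_sym p.2).
Qed.

Lemma cart_rel_irrefl : irreflexive cart_rel.
Proof. by move=> p; rewrite /cart_rel !adj_irrefl andbF. Qed.

Definition cart_prod : sgraph := SGraph cart_rel_sym cart_rel_irrefl.
End Cartesian.

(* For d >= 1 this is G [] (G [] ... [] G) with d factors; the power with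
   d = 0 is conventionally the one-vertex graph. *)
Definition cart_pow (G : sgraph) (d : nat) : sgraph :=
  iterop d cart_prod G (complete_graph 1).

(* A nonempty vertex set inducing a connected subgraph. *)
Definition connected_set (G : sgraph) (A : {set G}) : bool :=
  (A != set0) &&
  [forall x in A, forall y in A,
    connect (fun u v => [&& u \in A, v \in A & adj u v]) x y].

(* H is a minor of G: B u is the branch set of the vertex u of H, i.e. the
   set of vertices of G contracted to u. *)
Definition minor (H G : sgraph) : bool :=
  [exists B : {ffun H -> {set G}},
    [&& [forall u, connected_set (B u)],
        [forall u, forall v, (u != v) ==> [disjoint B u & B v]] &
        [forall u, forall v, adj u v ==>
          [exists x in B u, exists y in B v, adj x y]]]].

(* The bound k <= #|G| on the range of the maximum is harmless: see
   hadwigerP. *)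
Definition hadwiger (G : sgraph) : nat :=
  \max_(k < #|G|.+1 | minor (complete_graph k) G) k.

Lemma minor_card (H G : sgraph) : minor H G -> #|H| <= #|G|.
Proof.
case/existsP=> B /and3P[/forallP conB /forallP disB _].
have neB u : exists x, x \in B u.
  by apply/set0Pn; case/andP: (conB u).
pose f u := xchoose (neB u).
apply: (@leq_card _ _ f) => u v fuv; apply/eqP; apply/negPn/negP => neq_uv.
have /pred0P/(_ (f u)) := implyP (forallP (disB u) v) neq_uv.
by rewrite /= (xchooseP (neB u)) fuv (xchooseP (neB v)).
Qed.

Lemma minor_complete0 (G : sgraph) : minor (complete_graph 0) G.
Proof.
apply/existsP; exists [ffun=> set0].
by apply/and3P; split; apply/forallP; case.
Qed.

Lemma hadwigerP (G : sgraph) :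
  minor (complete_graph (hadwiger G)) G /\
  (forall k, minor (complete_graph k) G -> k <= hadwiger G).
Proof.
split.
  rewrite /hadwiger.
  have [|k mk ->] := @eq_bigmax_cond 'I_#|G|.+1
      [pred k : 'I__ | minor (complete_graph k) G] (fun k => k : nat).
    by apply/card_gt0P; exists ord0; rewrite inE /= minor_complete0.
  exact: mk.
move=> k mk; have ltk : k < #|G|.+1.
  by have := minor_card mk; rewrite card_ord.
exact: (@leq_bigmax_cond _ _ (fun i : 'I_#|G|.+1 => i : nat) (Ordinal ltk)).
Qed.

(* Main.v *)
(* Upper bound: a branch set B of a K_k minor spans at least 2 (#|B| - 1) arcs
   and emits k - 1 more, out of at most 2 d #|B|; summing over the branch sets
   gives k^2 <= 3 k + 2 (d - 1) n^d.

   Lower bound: write d = 2 m + 1 and q = n^m.  Since P_n^m has a Hamiltonian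
   path, P_n^d contains the q x q x n grid.  With s about sqrt n and h about
   q / 2, the layers of this grid are used alternately for columns and rows, so
   that each pair of the s classes of branch sets gets a column layer next to a
   row layer, where all the sets of one class cross all the sets of the other.
   This takes about s^2 layers and yields a K_(hs) minor. *)
Require Import Defs.
From mathcomp Require Import all_boot zify.

Set Implicit Arguments.
Unset Strict Implicit.
Unset Printing Implicit Defensive.

(** * Upper bound: counting arcs at the branch sets of a clique minor *)

Definition inner_arcs (G : sgraph) (S : {set G}) : {set G * G} :=
  [set p | [&& p.1 \in S, p.2 \in S & adj p.1 p.2]].

(** Otherwise [S] would be closed under the steps inside [A], and no path could lead from [S] to the
    rest of [A]. *)
Lemma connected_set_exit (G : sgraph) (A S : {set G}) :
    connected_set A -> S \subset A -> S != set0 -> S != A ->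
  exists u v, [/\ u \in S, v \in A, v \notin S & adj u v].
Proof.
case/andP=> _ /forall_inP conA SA /set0Pn[x xS] nSA.
have [y yA yS] : exists2 y, y \in A & y \notin S.
  by apply/subsetPn; move: nSA; rewrite eqEsubset SA.
have [/existsP[u /existsP[v /and4P[? ? ? ?]]]|no_exit] := boolP
    [exists u, [exists v, [&& u \in S, v \in A, v \notin S & adj u v]]].
  by exists u, v.
have stay u v : u \in S -> v \in A -> adj u v -> v \in S.
  move=> uS vA uv; apply: contraNT no_exit => vS.
  by apply/existsP; exists u; apply/existsP; exists v; apply/and4P.
have clS : closed (fun u v => [&& u \in A, v \in A & adj u v]) (mem S).
  move=> u v /and3P[uA vA uv]; apply/idP/idP => [uS|vS]; first exact: stay uv.
  by apply: stay vS uA _; rewrite adj_sym.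
have /forall_inP/(_ y yA) := conA x (subsetP SA x xS).
by move/(closed_connect clS); rewrite /= xS (negPf yS).
Qed.

(** Grow a subset of [A] vertex by vertex along exit edges, as for a spanning tree: each of the
    [#|A| - 1] new vertices brings an edge, hence two arcs. *)
Lemma connected_set_arcs (G : sgraph) (A : {set G}) :
  connected_set A -> (#|A|.*2 <= #|inner_arcs A| + 2)%N.
Proof.
move=> conA; have [A0 _] := andP conA.
have grow k : (k < #|A|)%N -> exists S : {set G},
    [/\ S \subset A, #|S| = k.+1 & (k.*2 <= #|inner_arcs S|)%N].
  elim: k => [|k IHk] ltkA.
    have /set0Pn[x xA] := A0.
    by exists [set x]; rewrite sub1set cards1.
  have [S [SA cS arcsS]] := IHk (ltnW ltkA).
  have [||u [v [uS vA vS uv]]] := connected_set_exit conA SA.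
  - by rewrite -card_gt0 cS.
  - by apply: contraTneq ltkA => <-; rewrite cS ltnn.
  exists (v |: S); split; first by rewrite subUset sub1set vA.
    by rewrite cardsU1 vS cS.
  have uv_neq : u != v by apply: contraNneq vS => <-.
  have cU : (#|inner_arcs S :|: [set (u, v); (v, u)]| = #|inner_arcs S| + 2)%N.
    rewrite cardsU cards2 xpair_eqE negb_and uv_neq /=.
    rewrite (_ : _ :&: _ = set0) ?cards0 ?subn0 //.
    apply/setP=> p; rewrite !inE; apply/negP => /andP[/and3P[p1 p2 _]].
    by case/orP=> /eqP pE; move: p1 p2; rewrite pE /= (negPf vS).
  rewrite doubleS -addn2 (leq_trans (leq_add arcsS (leqnn 2))) // -cU.
  apply/subset_leq_card/subsetP=> p; rewrite !inE.
  case/orP=> [/and3P[-> -> ->]|]; first by rewrite !orbT.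
  by case/orP=> /eqP-> /=; rewrite uS eqxx ?orbT //= adj_sym.
move: A0; rewrite -card_gt0 => A0.
have [|S [SA cS arcsS]] := grow #|A|.-1; first by rewrite prednK.
have SE : S = A by apply/eqP; rewrite eqEcard SA cS prednK /=.
by move: arcsS; rewrite SE; lia.
Qed.

(* Each of the other [k - 1] branch sets absorbs an arc leaving [B u], and
   connectivity keeps [2 (#|B u| - 1)] arcs inside [B u]. *)
Lemma clique_minor_bound (G : sgraph) (D k : nat) :
    (forall x : G, #|[set y | adj x y]| <= D) -> 2 <= D ->
    minor (complete_graph k) G ->
  k * k <= 3 * k + (D - 2) * #|G|.
Proof.
move=> degG D2 /existsP[B /and3P[/forallP conB /forallP disB /forallP adjB]].
have dis u v x : x \in B u -> x \in B v -> u = v.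
  move=> xu xv; apply/eqP/negPn/negP => uv.
  have /pred0P/(_ x) := implyP (forallP (disB u) v) uv.
  by rewrite /= xu xv.
have one (u : complete_graph k) : k <= 3 + (D - 2) * #|B u|.
  pose out := [set p : G * G | (p.1 \in B u) && adj p.1 p.2].
  have le_out : #|out| <= #|B u| * D.
    rewrite -sum1_card (eq_bigl (fun p => (p.1 \in B u) && adj p.1 p.2));
      last by move=> p; rewrite inE.
    rewrite -(pair_big_dep (fun x => x \in B u) (fun x y => adj x y)
                (fun _ _ => 1)) /=.
    rewrite -sum_nat_const; apply: leq_sum => x _.
    by rewrite sum1_card -cardsE degG.
  have exit v : u != v ->
      exists p : G * G, [&& p.1 \in B u, p.2 \in B v & adj p.1 p.2].
    move=> uv; have /exists_inP[x xu /exists_inP[y yv xy]] :=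
      implyP (forallP (adjB u) v) uv.
    by exists (x, y); apply/and3P.
  have [x0 _] : exists x, x \in B u by apply/set0Pn; case/andP: (conB u).
  (* The default [(x0, x0)] can only occur at [v = u], which is excluded below. *)
  pose arc v := if [pick p : G * G | [&& p.1 \in B u, p.2 \in B v & adj p.1 p.2]]
                is Some p then p else (x0, x0).
  have arcP v : u != v -> [&& (arc v).1 \in B u, (arc v).2 \in B v
                            & adj (arc v).1 (arc v).2].
    move=> uv; rewrite /arc; case: pickP => // no.
    by have [p] := exit v uv; rewrite no.
  have card_arcs : #|[set arc v | v in [set~ u]]| = k.-1.
    rewrite card_in_imset ?cardsC1 ?card_ord // => v w.
    rewrite !inE ![_ == u]eq_sym => /arcP/and3P[_ v2 _] /arcP/and3P[_ w2 _] vw.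
    by apply: dis v2 _; rewrite vw.
  have : #|inner_arcs (B u) :|: [set arc v | v in [set~ u]]| <= #|out|.
    apply/subset_leq_card/subsetP=> p; rewrite !inE.
    case/orP=> [/and3P[-> _ ->] //|/imsetP[v]].
    by rewrite !inE eq_sym => /arcP/and3P[? _ ?] ->; apply/andP.
  rewrite cardsU (_ : _ :&: _ = set0) ?cards0 ?subn0; last first.
    apply/setP=> p; rewrite !inE; apply/negP=> /andP[/and3P[_ p2 _] /imsetP[v]].
    rewrite !inE eq_sym => uv pE; have /and3P[_ v2 _] := arcP v uv.
    by move: uv; rewrite (dis u v p.2) ?eqxx // pE.
  (* This keeps the truncated difference [D * #|B u| - 2 * #|B u|] from collapsing to 0. *)
  have leD : 2 * #|B u| <= D * #|B u| by rewrite leq_mul2r D2 orbT.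
  have := connected_set_arcs (conB u); rewrite card_arcs mulnBl.
  rewrite mulnC in le_out.
  move: leD le_out; move: #|B u| #|out| #|inner_arcs _| => b o i.
  by move: (D * b) => Db; lia.
have card_cover : \sum_u #|B u| <= #|G|.
  rewrite -sum1_card (eq_bigr (fun u => \sum_(x : G) (x \in B u : nat))) =>
    [|u _]; last by rewrite -sum1_card big_mkcond; apply: eq_bigr.
  rewrite exchange_big; apply: leq_sum => x _ /=.
  have [/existsP[u xu]|no] := boolP [exists u, x \in B u].
    rewrite (bigD1 u) //= big1 ?addn0 ?xu // => v vu.
    by case xv: (x \in B v) => //; rewrite (dis v u x) ?eqxx in vu.
  rewrite big1 // => u _; case xu: (x \in B u) => //.
  by case/negP: no; apply/existsP; exists u.
have -> : k * k = \sum_(u : complete_graph k) k.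
  by rewrite sum_nat_const card_ord.
have /leq_trans : \sum_(u : complete_graph k) k <=
    \sum_(u : complete_graph k) (3 + (D - 2) * #|B u|).
  by apply: leq_sum => u _; apply: one.
apply.
rewrite big_split /= sum_nat_const card_ord mulnC -big_distrr /=.
by rewrite leq_add2l leq_mul2l card_cover orbT.
Qed.

(** * Degree and order of the powers of a path *)

Lemma path_graph_degree n (x : path_graph n) : #|[set y | adj x y]| <= 2.
Proof.
(* At [x = 0] the second entry is 0 itself, which is harmless: the list only has to contain all
   neighbours. *)
rewrite cardE -(size_map val); apply: (@uniq_leq_size _ _ [:: x.+1; x.-1]).
  by rewrite (map_inj_uniq val_inj) enum_uniq.
move=> _ /mapP[y + ->]; rewrite mem_enum !inE => /orP[] /eqP.
  by move=> ->; rewrite eqxx.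
by move=> <-; rewrite eqxx orbT.
Qed.

Lemma cart_prod_degree (G H : sgraph) D E :
    (forall x : G, #|[set y | adj x y]| <= D) ->
    (forall x : H, #|[set y | adj x y]| <= E) ->
  forall x : cart_prod G H, #|[set y | adj x y]| <= D + E.
Proof.
move=> degG degH [x1 x2]; apply: leq_trans (leq_add (degG x1) (degH x2)).
rewrite -(card_imset [set y | adj x1 y] (f := fun y => (y, x2))) => [|? ? []//].
rewrite -(card_imset [set y | adj x2 y] (f := fun y => (x1, y))) => [|? ? []//].
apply: leq_trans (leq_card_setU _ _).
apply/subset_leq_card/subsetP=> -[y1 y2]; rewrite !inE.
case/orP=> /andP[/= h1 h2]; apply/orP; [left|right].
  by apply/imsetP; exists y1; rewrite ?inE // -(eqP h2).
by apply/imsetP; exists y2; rewrite ?inE // -(eqP h1).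
Qed.

Lemma cart_powS (G : sgraph) d :
  cart_pow G d.+2 = cart_prod G (cart_pow G d.+1).
Proof. by []. Qed.

Lemma path_pow_degree n d (x : cart_pow (path_graph n) d.+1) :
  #|[set y | adj x y]| <= 2 * d.+1.
Proof.
elim: d x => [|d IHd] x; first exact: path_graph_degree.
rewrite mulnS; exact: (cart_prod_degree (@path_graph_degree n) IHd).
Qed.

Lemma card_path_pow n d : #|cart_pow (path_graph n) d.+1| = n ^ d.+1.
Proof.
elim: d => [|d IHd]; first by rewrite card_ord.
by rewrite cart_powS [LHS]card_prod card_ord IHd -expnS.
Qed.

(** * Three-dimensional grids inside odd powers of a path *)

(** An embedding of the [A * B * C] grid as a subgraph, not necessarily induced. Coordinates are
    natural numbers constrained only by bounds, so that later index computations stay in [nat]. *)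
Definition grid_map (G : sgraph) (A B C : nat) (c : nat -> nat -> nat -> G) :=
  [/\ forall x y z x' y' z', x < A -> y < B -> z < C ->
        x' < A -> y' < B -> z' < C ->
        c x y z = c x' y' z' -> [/\ x = x', y = y' & z = z'],
      forall x y z, x.+1 < A -> y < B -> z < C -> adj (c x y z) (c x.+1 y z),
      forall x y z, x < A -> y.+1 < B -> z < C -> adj (c x y z) (c x y.+1 z)
    & forall x y z, x < A -> y < B -> z.+1 < C -> adj (c x y z) (c x y z.+1)].

Definition has_grid (G : sgraph) (A B C : nat) : Prop :=
  exists c, @grid_map G A B C c.

Lemma has_grid_path n : has_grid (path_graph n.+1) 1 1 n.+1.
Proof.
exists (fun _ _ z => inord z); split; try by lia.
  move=> [|x] [|y] z [|x'] [|y'] z' // _ _ zn _ _ z'n /(congr1 val) /=.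
  by rewrite !inordK.
by move=> x y z _ _ zn; rewrite /= /path_rel !inordK ?eqxx // ltnW.
Qed.

Lemma has_grid_swap G A B C : has_grid G A B C -> has_grid G B A C.
Proof.
case=> c [inj ax ay az]; exists (fun x y z => c y x z); split; auto.
by move=> x y z x' y' z' *; have [] := inj y x z y' x' z'.
Qed.

Lemma has_grid_sub G A B C A' B' C' :
  A' <= A -> B' <= B -> C' <= C -> has_grid G A B C -> has_grid G A' B' C'.
Proof.
move=> lA lB lC [c [inj ax ay az]]; exists c; split.
- by move=> x y z x' y' z' *; apply: inj => //; lia.
- by move=> *; apply: ax; lia.
- by move=> *; apply: ay; lia.
- by move=> *; apply: az; lia.
Qed.

(* Boustrophedon: successive copies of the grid are traversed in alternating
   directions along the first coordinate. *)
Lemma has_grid_snake n H A B C : has_grid H A B C ->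
  has_grid (cart_prod (path_graph n.+1) H) (n.+1 * A) B C.
Proof.
case=> c [inj ax ay az].
case: A => [|A] in inj ax ay az *.
  rewrite muln0.
  by exists (fun x y z => (ord0, c x y z)); split; move=> x y z; lia.
pose col k := if odd (k %/ A.+1) then A - k %% A.+1 else k %% A.+1.
have col_lt k : col k < A.+1.
  by rewrite /col; case: odd; rewrite ?ltn_mod // ltnS leq_subr.
have row_lt k : k < n.+1 * A.+1 -> k %/ A.+1 < n.+1.
  by rewrite ltn_divLR.
exists (fun x y z => (inord (x %/ A.+1), c (col x) y z)); split.
- move=> x y z x' y' z' lx ly lz lx' ly' lz' [/(congr1 val) /=].
  rewrite !inordK ?row_lt // => eq_row /inj[] // eq_col -> ->; split=> //.
  rewrite (divn_eq x A.+1) (divn_eq x' A.+1) eq_row; congr (_ + _).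
  move: eq_col; rewrite /col eq_row; case: odd => //.
  by have := ltn_pmod x (ltn0Sn A); have := ltn_pmod x' (ltn0Sn A); lia.
- move=> x y z lx ly lz /=; rewrite /cart_rel /=.
  (* At the end of a traversal the snake enters the next copy of [H] with its column unchanged,
     thanks to the reversal; elsewhere it moves by one column inside a copy. *)
  have := ltn_pmod x (ltn0Sn A); rewrite ltnS leq_eqVlt => /orP[/eqP xA|xA].
    have xE : x.+1 = (x %/ A.+1).+1 * A.+1.
      by rewrite {1}(divn_eq x A.+1) xA mulSn; lia.
    have rowE : x.+1 %/ A.+1 = (x %/ A.+1).+1 by rewrite xE mulnK.
    have colE : x.+1 %% A.+1 = 0 by rewrite xE modnMl.
    rewrite /path_rel !inordK ?row_lt ?(ltnW lx) // rowE eqxx /=.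
    by rewrite /col rowE colE xA /=; case: odd; rewrite /= ?subn0 ?subnn eqxx.
  have xA' : (x %% A.+1).+1 < A.+1 by rewrite ltnS.
  have xE : x.+1 = (x %/ A.+1) * A.+1 + (x %% A.+1).+1.
    by rewrite addnS -divn_eq.
  have rowE : x.+1 %/ A.+1 = x %/ A.+1.
    by rewrite {1}xE divnMDl // (divn_small xA') addn0.
  have colE : x.+1 %% A.+1 = (x %% A.+1).+1.
    by rewrite {1}xE modnMDl (modn_small xA').
  rewrite rowE eqxx /=; apply/orP; right; rewrite /col rowE colE.
  case: odd; last exact: ax.
  rewrite adj_sym (_ : A - x %% A.+1 = (A - (x %% A.+1).+1).+1); last by lia.
  by apply: ax => //; lia.
- by move=> x y z *; rewrite /= /cart_rel /= eqxx ay ?orbT.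
- by move=> x y z *; rewrite /= /cart_rel /= eqxx az ?orbT.
Qed.

(** One factor provides the third side. Snaking [m] further factors builds one long side; after a
    swap, the last [m] factors build the other. *)
Lemma has_grid_path_pow n m :
  has_grid (cart_pow (path_graph n.+1) m.*2.+1) (n.+1 ^ m) (n.+1 ^ m) n.+1.
Proof.
have pow_grid k j A B : has_grid (cart_pow (path_graph n.+1) k.+1) A B n.+1 ->
    has_grid (cart_pow (path_graph n.+1) (j + k).+1) (n.+1 ^ j * A) B n.+1.
  move=> grid; elim: j => [|j IHj]; first by rewrite mul1n.
  by rewrite addSn cart_powS expnS -mulnA; apply: has_grid_snake.
have := pow_grid 0 m 1 1 (has_grid_path n); rewrite addn0 muln1.
by move/has_grid_swap/(pow_grid _ m); rewrite addnn muln1.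
Qed.

(** * The clique minor in a three-dimensional grid *)

Definition inside (G : sgraph) (A : {set G}) : rel G :=
  fun u v => [&& u \in A, v \in A & adj u v].

Lemma inside_sym (G : sgraph) (A : {set G}) : connect_sym (inside A).
Proof.
by apply: sym_connect_sym => u v; rewrite /inside adj_sym andbCA andbA.
Qed.

Lemma connect_line (G : sgraph) (A : {set G}) (f : nat -> G) lo hi :
    lo <= hi -> (forall k, lo <= k <= hi -> f k \in A) ->
    (forall k, lo <= k < hi -> adj (f k) (f k.+1)) ->
  connect (inside A) (f lo) (f hi).
Proof.
move=> le_lo_hi; rewrite -(subnKC le_lo_hi); elim: (hi - lo) => [|k IHk] fA fadj.
  by rewrite addn0.
rewrite addnS; apply: connect_trans (IHk _ _) (connect1 _).
- by move=> j lj; apply: fA; lia.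
- by move=> j lj; apply: fadj; lia.
- by apply/and3P; split; [apply: fA | apply: fA | apply: fadj]; lia.
Qed.

(** One of the two directed distances between [a] and [b] on a cycle of length [s] is at most
    [s / 2]. Hence [s./2.+1] offsets per class suffice to realise all pairs of classes. *)
Lemma cyclic_gap s a b : a < s -> b < s ->
  exists2 r, r < s./2.+1 & (b + r) %% s = a \/ (a + r) %% s = b.
Proof.
wlog ab : a b / a <= b.
  move=> gap sa sb; have [/gap|/ltnW/gap] := leqP a b; first exact.
  by case=> // r rs ?; exists r; tauto.
move=> sa sb; have [le_ba|lt_ba] := leqP (b - a) s./2.
  by exists (b - a) => //; right; rewrite subnKC // modn_small.
exists (s - (b - a)); first by lia.
by left; rewrite (_ : b + _ = a + s) ?modnDr ?modn_small //; lia.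
Qed.

(** Layers [2t] and [2t+1] form a pair, and [s./2.+1] consecutive pairs form a block. In block [b],
    the pair at offset [r] is devoted to the classes [b] (columns) and [b + r] modulo [s] (rows). *)
Definition block s z := z./2 %/ s./2.+1.

Definition partner s z := (block s z + z./2 %% s./2.+1) %% s.

(* The branch sets of K_(hs) are indexed by pairs (i, a) with i < h, a < s.
   Branch set (i, a) has a pole in the strip x < s, at x = a and y = 2i, 2i+1.
   In an odd layer z, the sets (i, a) with a = partner z run along the rows
   y = 2i+1; in an even layer, the sets (j, b) with b = block z fill the
   columns x = s+j, meeting all those rows.  The even rows of odd layers link
   the columns of consecutive layers of a block. *)
Definition owner s x y z : nat * nat :=
  if [&& odd z, odd y & partner s z <= x] then (y./2, partner s z)
  else if x < s then (y./2, x) else (x - s, block s z).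

(** Branch sets are the fibres of [owner], disjoint because the grid map is injective. Set [(i, a)]
    is connected because each of its vertices is joined to the foot [c a i.*2 0] of its pole, and
    [cyclic_gap] selects a layer pair where two given sets touch. *)
Lemma grid_clique_minor (G : sgraph) s h : 0 < s ->
    has_grid G (s + h) h.*2 (s * s./2.+1).*2 ->
  minor (complete_graph (h * s)) G.
Proof.
move=> s0 [c [inj ax ay az]]; set T := s./2.+1 in inj ax ay az.
pose br u : {set G} := [set g | [exists x : 'I_(s + h), [exists y : 'I_(h.*2),
  [exists z : 'I_(s * T).*2, (g == c x y z) && (owner s x y z == u)]]]].
have brP u g : reflect (exists x y z, [/\ x < s + h, y < h.*2, z < (s * T).*2,
    owner s x y z = u & g = c x y z]) (g \in br u).
  rewrite inE; apply: (iffP existsP) => [[x /existsP[y /existsP[z]]]|].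
    by case/andP=> /eqP gE /eqP oE; exists x, y, z.
  case=> x [y [z [lx ly lz oE ->]]]; exists (Ordinal lx).
  apply/existsP; exists (Ordinal ly); apply/existsP; exists (Ordinal lz).
  by rewrite /= oE !eqxx.
have br_owner u x y z : x < s + h -> y < h.*2 -> z < (s * T).*2 ->
    owner s x y z = u -> c x y z \in br u.
  by move=> *; apply/brP; exists x, y, z.
have block_lt z : z < (s * T).*2 -> block s z < s.
  by rewrite /block => lz; rewrite ltn_divLR // -/T; lia.
have partner_lt z : partner s z < s by rewrite ltn_mod.
have owner_pole x y z : x < s -> ~~ odd y || ~~ odd z ->
    owner s x y z = (y./2, x).
  by move=> lx; rewrite /owner lx; case: odd; case: odd.
have owner_row x y z : odd y -> odd z -> partner s z <= x ->
    owner s x y z = (y./2, partner s z).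
  by move=> oy oz lx; rewrite /owner oy oz lx.
have owner_col x y z : s <= x -> ~~ odd y || ~~ odd z ->
    owner s x y z = (x - s, block s z).
  by move=> lx; rewrite /owner ltnNge lx; case: odd; case: odd.
pose join u := connect (inside (br u)).
have joinC u : connect_sym (inside (br u)) by apply: inside_sym.
have line_x u x1 x2 y z : x1 <= x2 < s + h -> y < h.*2 -> z < (s * T).*2 ->
    (forall x, x1 <= x <= x2 -> owner s x y z = u) ->
    join u (c x1 y z) (c x2 y z).
  move=> /andP[l1 l2] ly lz oE; apply: (connect_line (f := fun x => c x y z)) =>
    // k lk; [by apply: br_owner; rewrite ?oE //; lia | by apply: ax; lia].
have line_y u x y1 y2 z : x < s + h -> y1 <= y2 < h.*2 -> z < (s * T).*2 ->
    (forall y, y1 <= y <= y2 -> owner s x y z = u) ->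
    join u (c x y1 z) (c x y2 z).
  move=> lx /andP[l1 l2] lz oE; apply: (connect_line (f := fun y => c x y z)) =>
    // k lk; [by apply: br_owner; rewrite ?oE //; lia | by apply: ay; lia].
have line_z u x y z1 z2 : x < s + h -> y < h.*2 -> z1 <= z2 < (s * T).*2 ->
    (forall z, z1 <= z <= z2 -> owner s x y z = u) ->
    join u (c x y z1) (c x y z2).
  move=> lx ly /andP[l1 l2] oE; apply: (connect_line (f := fun z => c x y z)) =>
    // k lk; [by apply: br_owner; rewrite ?oE //; lia | by apply: az; lia].
(* Rows only occupy odd [y], so the line [y = 2i] of a pole is never interrupted. *)
have pole i a z : i < h -> a < s -> z < (s * T).*2 ->
    join (i, a) (c a i.*2 0) (c a i.*2 z).
  move=> li la lz; apply: line_z; try lia.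
  by move=> z' _; rewrite owner_pole ?odd_double ?doubleK.
have row i x z : i < h -> x < s + h -> z < (s * T).*2 -> odd z ->
    partner s z <= x ->
    join (i, partner s z) (c (partner s z) i.*2 0) (c x i.*2.+1 z).
  move=> li lx lz oz px; apply: connect_trans (pole i _ z _ _ _) _ => //.
  apply: (connect_trans (y := c (partner s z) i.*2.+1 z)).
    apply: line_y; try lia; move=> y ly; have := partner_lt z => lp.
     have [oy|ey] := boolP (odd y).
      by rewrite owner_row //; congr (_, _); lia.
    by rewrite owner_pole ?ey //; congr (_, _); lia.
  apply: line_x; try lia.
  by move=> x' lx'; rewrite owner_row //=; [congr (_, _); lia | rewrite odd_double | lia].
have root i a x y z : x < s + h -> y < h.*2 -> z < (s * T).*2 ->
    owner s x y z = (i, a) -> join (i, a) (c a i.*2 0) (c x y z).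
  move=> lx ly lz; have [/and3P[oz oy px]|nrow] :=
    boolP [&& odd z, odd y & partner s z <= x].
    rewrite owner_row // => -[<- <-].
    by rewrite {3}(_ : y = y./2.*2.+1); [apply: row => //; lia | lia].
  have [xs|sx] := ltnP x s.
    rewrite /owner (negPf nrow) xs => -[<- <-].
    apply: connect_trans (pole _ _ z _ _ _) _ => //; first by lia.
    apply: line_y => //; first by lia.
    move=> y' ly'; rewrite /owner xs.
    case: ifP => [rowy'|_]; last by congr (_, _); lia.
    case/negP: nrow; suff -> : y = y' by [].
    by move: rowy' => /and3P[_ oy' _]; lia.
  have evz : ~~ odd y || ~~ odd z.
    move: nrow; have := partner_lt z; case: odd; case: odd => //=.
    by rewrite -ltnNge; lia.
  rewrite owner_col // => -[<- <-]; set i0 := x - s; set b := block s z.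
  have bs : b < s by apply: block_lt.
  (* First layer of block [b]. The pair [z0], [z0.+1] has offset 0, so the rows of layer [z0.+1]
     belong to class [b] itself and tie its columns to its poles. *)
  set z0 := (b * T).*2.
  have z0z : z0 <= z./2.*2.
    by rewrite /z0 /b /block -/T leq_double leq_trunc_div.
  have lz0 : z0.+1 < (s * T).*2.
    have : b.+1 * T <= s * T by rewrite leq_mul2r bs orbT.
    by rewrite mulSn /z0; lia.
  have blockE z' : z0 <= z' <= z./2.*2.+1 -> block s z' = b.
    move=> lz'; apply/eqP; rewrite eqn_leq; apply/andP; split.
      by apply: leq_div2r; lia.
    by rewrite /block leq_divRL // -/T; move: lz'; rewrite /z0; lia.
  have li0 : i0 < h by rewrite /i0; lia.
  have xE : x = s + i0 by rewrite subnKC.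
  have partner0 : partner s z0.+1 = b.
    rewrite /partner blockE; last by lia.
    rewrite (_ : z0.+1./2 = b * T) ?modnMl ?addn0 ?modn_small //.
    by rewrite /z0 /= uphalf_double.
  have := row i0 x z0.+1; rewrite partner0 /= odd_double => base.
  apply: connect_trans (base _ _ _ _ _) _ => //; first by lia.
  (* Route from the vertex to the base row: to the even layer of its pair, along the column to
     [y = 0], through the layers of the block to [z0] on this even line, along the column to
     [y = 2 * i0 + 1], then one layer up. *)
  rewrite joinC; apply: (connect_trans (y := c x y z./2.*2)).
    rewrite joinC; apply: line_z => //; first by lia.
    move=> z' lz'; rewrite owner_col //; last first.
      have [->|] := eqVneq z' z; first by [].
      by lia.
    by rewrite blockE //; lia.
  apply: (connect_trans (y := c x 0 z./2.*2)).
    rewrite joinC; apply: line_y => //; try lia.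
    by move=> y' _; rewrite owner_col ?odd_double ?orbT // blockE //; lia.
  apply: (connect_trans (y := c x 0 z0)).
    rewrite joinC; apply: line_z => //; try lia.
    by move=> z' lz'; rewrite owner_col // blockE //; lia.
  apply: (connect_trans (y := c x i0.*2.+1 z0)).
    apply: line_y => //; try lia.
    by move=> y' _; rewrite owner_col ?odd_double ?orbT // blockE //; lia.
  apply: line_z => //; try lia.
  move=> z' lz'; have [->|nz'] := eqVneq z' z0.
    by rewrite owner_col ?odd_double ?orbT // blockE //; lia.
  rewrite (_ : z' = z0.+1); last by lia.
  rewrite owner_row /= ?odd_double //; last by rewrite partner0; lia.
  by rewrite partner0 uphalf_double.
pose idx (u : complete_graph (h * s)) := (u %/ s, u %% s).
have idx_lt u : (idx u).1 < h /\ (idx u).2 < s.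
  by rewrite /idx /= ltn_mod s0 ltn_divLR.
apply/existsP; exists [ffun u => br (idx u)]; apply/and3P; split.
- apply/forallP=> u; rewrite ffunE; have [li la] := idx_lt u.
  case: (idx u) li la => i a /= li la; apply/andP; split.
    apply/set0Pn; exists (c a i.*2 0); apply: br_owner; try lia.
    by rewrite owner_pole ?odd_double ?doubleK.
  apply/forall_inP=> g /brP[x [y [z [lx ly lz oE ->]]]].
  apply/forall_inP=> g' /brP[x' [y' [z' [lx' ly' lz' oE' ->]]]].
  apply: (connect_trans (y := c a i.*2 0)); last exact: root.
  by rewrite -/(inside _) joinC; apply: root.
- apply/forallP=> u; apply/forallP=> v; apply/implyP; apply: contraNT.
  rewrite !ffunE => /pred0Pn[g /andP[/= /brP[x [y [z [lx ly lz oE ->]]]]]].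
  case/brP=> x' [y' [z' [lx' ly' lz' oE' cE]]].
  have [ex ey ez] := inj _ _ _ _ _ _ lx ly lz lx' ly' lz' cE.
  move: oE; rewrite ex ey ez oE' /idx => -[eq_div eq_mod].
  by apply/eqP/val_inj; rewrite /= (divn_eq u s) (divn_eq v s) eq_div eq_mod.
have meet i a j b r : i < h -> j < h -> a < s -> b < s -> r < T ->
    (b + r) %% s = a ->
    exists g g', [/\ g \in br (i, a), g' \in br (j, b) & adj g g'].
  (* The layer pair at offset [r] of block [b]. At [x = s + j], [y = 2i + 1], its odd layer carries
     row [i] of class [a] and its even layer carries column [j] of class [b]. *)
  move=> li lj la lb lr ab; pose t := b * T + r.
  have lt : t < s * T.
    have : b.+1 * T <= s * T by rewrite leq_mul2r lb orbT.
    by rewrite mulSn /t; lia.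
  have block0 : block s t.*2 = b.
    by rewrite /block doubleK /t divnMDl // (divn_small lr) addn0.
  have partner1 : partner s t.*2.+1 = a.
    rewrite /partner /block /= uphalf_double -/T /t divnMDl // (divn_small lr).
    by rewrite addn0 modnMDl (modn_small lr).
  exists (c (s + j) i.*2.+1 t.*2.+1), (c (s + j) i.*2.+1 t.*2); split.
  + apply: br_owner; try lia.
    rewrite owner_row /= ?odd_double // partner1 ?uphalf_double //; lia.
  + apply: br_owner; try lia.
    rewrite owner_col ?odd_double ?orbT ?leq_addr // block0 addKn //.
  + by rewrite adj_sym; apply: az; lia.
apply/forallP=> u; apply/forallP=> v; apply/implyP=> _; rewrite !ffunE.
have [[li la] [lj lb]] := (idx_lt u, idx_lt v).
case: (idx u) (idx v) li la lj lb => i a [j b] /= li la lj lb.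
have [r lr [ab|ba]] := cyclic_gap la lb.
  have [g [g' [gu gv gg]]] := meet i a j b r li lj la lb lr ab.
  by apply/exists_inP; exists g => //; apply/exists_inP; exists g'.
have [g [g' [gv gu gg]]] := meet j b i a r lj li lb la lr ba.
by apply/exists_inP; exists g' => //; apply/exists_inP; exists g; rewrite // adj_sym.
Qed.

(** * Choice of parameters and the final estimates *)

Lemma exists_sqrt_floor n : exists r, r * r <= n < r.+1 * r.+1.
Proof.
elim: n => [|n [r /andP[le_r lt_r]]]; first by exists 0.
have [le_n|lt_n] := leqP (r.+1 * r.+1) n.+1; last by exists r; lia.
by exists r.+1; lia.
Qed.

(** With [r - 1] classes, the number of layers is at most [(r - 1) * (r + 1) < r * r <= n.+1]. The
    other sides fit because [r * r <= n.+1 <= n.+1 ^ m]. *)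
Lemma hadwiger_path_pow_ge n m r : 0 < m -> r * r <= n.+1 ->
  (n.+1 ^ m)./2 * r.-1 <= hadwiger (cart_pow (path_graph n.+1) m.*2.+1).
Proof.
case: r => [|[|s]] m0 le_r /=; rewrite ?muln0 //.
apply: (hadwigerP _).2; apply: grid_clique_minor => //.
have le_nm : n.+1 <= n.+1 ^ m by rewrite -{1}[n.+1]expn1 leq_pexp2l.
apply: has_grid_sub (has_grid_path_pow n m); try lia.
have := leq_mul2l s.+1 s.+1./2.+1.*2 s.+3; rewrite doubleMr; lia.
Qed.

Lemma hadwiger_path_pow_le n d :
  hadwiger (cart_pow (path_graph n) d.+1) * hadwiger (cart_pow (path_graph n) d.+1)
    <= 3 * hadwiger (cart_pow (path_graph n) d.+1) + 2 * d * n ^ d.+1.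
Proof.
have := clique_minor_bound (@path_pow_degree n d) _ (hadwigerP _).1.
by rewrite card_path_pow mulnS addKn; apply.
Qed.

From HB Require Import structures.
From mathcomp Require Import all_order all_algebra.
From mathcomp Require Import all_classical all_reals all_analysis.
From mathcomp Require Import ring lra.
Import Order.TTheory GRing.Theory Num.Theory.
Local Open Scope ring_scope.

Lemma powR_half_odd (R : realType) (n m : nat) :
  (n.+1%:R : R) `^ (m.*2.+1%:R / 2) = n.+1%:R ^+ m * Num.sqrt n.+1%:R.
Proof.
rewrite (_ : _ / 2 = m%:R + 2^-1); last first.
  by rewrite -addn1 natrD -muln2 natrM; field.
by rewrite powRD ?powR_mulrn ?powR12_sqrt // pnatr_eq0 implybT.
Qed.

Theorem mainTheorem7 (R : realType) (d : nat) (hd : (3 <= d)%N)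
    (hodd : odd d) :
  exists C : R, forall n : nat, (1 <= n)%N ->
    1 / 2 * (n%:R : R) `^ (d%:R / 2) - C * (n%:R : R) `^ ((d%:R - 1) / 2)
      < (hadwiger (cart_pow (path_graph n) d))%:R
      <= Num.sqrt (2 * (d%:R - 1)) * (n%:R : R) `^ (d%:R / 2) + 3.
Proof.
have [m m0 ->] : exists2 m, (0 < m)%N & d = m.*2.+1 by exists d./2; lia.
(* With [q = n^m] and [w = sqrt n <= q], the minor has order at least [(q - 1) / 2] times a
   nonnegative number that is at least [w - 2]. This falls short of [q * w / 2] by at most
   [q + w / 2 - 1 < 2 * q]. *)
exists 2 => -[//|n] _; rewrite powR_half_odd.
have -> : ((m.*2.+1%:R : R) - 1) / 2 = m%:R.
  by rewrite -addn1 natrD -muln2 natrM; field.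
rewrite powR_mulrn //; set k := hadwiger _.
set w := Num.sqrt _; have w0 : 0 <= w :> R by apply: sqrtr_ge0.
have ww : w * w = n.+1%:R by rewrite -expr2 sqr_sqrtr.
apply/andP; split.
  have [r /andP[le_r lt_r]] := exists_sqrt_floor n.+1.
  have := hadwiger_path_pow_ge m0 le_r; rewrite -(ler_nat R) natrM -/k.
  apply: lt_le_trans.
  have lt_w : w < r%:R + 1.
    rewrite -(@ltr_pXn2r _ 2) ?nnegrE //.
    by rewrite !expr2 ww natr1 -natrM ltr_nat.
  have le_s : w - 2 <= r.-1%:R.
    case: r {le_r lt_r} lt_w => [|r] /=; first by lra.
    by rewrite -natr1; lra.
  have le_w : w <= n.+1%:R ^+ m.
    rewrite -natrX -(@ler_pXn2r _ 2) ?nnegrE // !expr2 ww -natrM ler_nat.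
    have le_nm : (n.+1 <= n.+1 ^ m)%N by rewrite -{1}[n.+1]expn1 leq_pexp2l.
    by apply: leq_trans le_nm _; rewrite leq_pmulr // expn_gt0.
  have le_h : n.+1%:R ^+ m - 1 <= 2 * (n.+1 ^ m)./2%:R :> R.
    rewrite -natrX -natrM lerBlDr natr1 ler_nat; lia.
  have q1 : 1 <= n.+1%:R ^+ m :> R by rewrite -natrX ler1n expn_gt0.
  set q : R := n.+1%:R ^+ m in le_w le_h q1 *.
  have s0 : 0 <= r.-1%:R :> R by [].
  nra.
have := hadwiger_path_pow_le n.+1 m.*2; rewrite -/k -(ler_nat R).
rewrite natrD !natrM natrX => le_k.
rewrite -[_ - 1](_ : m.*2%:R = _); last by rewrite -natr1 addrK.
(* Above 3, the counting bound gives [(k - 3)^2 <= k * (k - 3) <= 2 * (d - 1) * n^d], and square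
   roots can be compared since [k - 3] is nonnegative. *)
have [k3|k3] := leqP k 3.
  have : k%:R <= 3 :> R by rewrite ler_nat.
  have : 0 <= Num.sqrt (2 * m.*2%:R) * (n.+1%:R ^+ m * w) :> R.
    by rewrite !mulr_ge0 ?sqrtr_ge0.
  lra.
have {}k3 : 3 <= k%:R :> R by rewrite ler_nat ltnW.
rewrite -lerBlDr -(@ler_pXn2r _ 2) ?nnegrE ?subr_ge0 //; last first.
  by rewrite !mulr_ge0 ?sqrtr_ge0.
rewrite exprMn sqr_sqrtr ?mulr_ge0 // exprMn -exprM muln2 [w ^+ 2]expr2 ww.
rewrite -exprSr; nra.
Qed.
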